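(* Let $n\ge 2$ and let players $1,\dots,n$ have values $v_1 \ge v_2 \ge \cdots \ge v_n > 0$. Then for every random knockout tournament format $(r,m_1,\dots,m_r)$ the win probabilities satisfy $$P_1 \geq \frac{v_1}{\sum_{j=1}^n v_j}, \qquad P_n \leq \frac{v_n}{\sum_{j=1}^n v_j}.$$
   Context: Random knockout tournament: there are $n\ge 2$ players $1,\dots,n$ with positive values $v_1,\dots,v_n$. A format is a tuple $(r,m_1,\dots,m_r)$ of positive integers with $\sum_{s=1}^r m_s = n-1$ and $2m_s \le r_s$ for each $s$, where $r_s = n-\sum_{j=1}^{s-1} m_j$ is the number of players still alive (not eliminated) at the start of round $s$. In round $s$, independently of the past given the set of alive players, $2m_s$ of the $r_s$ alive players are chosen uniformly at random and are uniformly randomly arranged into $m_s$ match pairs. A match between $i$ and $j$ is won by $i$ with probability $v_i/(v_i+v_j)$, independently of everything else. Losers are eliminated; the winners and the alive players not chosen to play advance to the next round. After round $r$ exactly one player remains, the winner of the tournament. $P_i$ denotes the probability that player $i$ wins the tournament. *)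

(* Defs.v *)
From HB Require Import structures.
From mathcomp Require Import all_boot all_order all_algebra.
From mathcomp Require Import reals.
Set Implicit Arguments.
Unset Strict Implicit.
Unset Printing Implicit Defensive.
Import Order.TTheory GRing.Theory Num.Theory.
Local Open Scope ring_scope.

(* Rounds are indexed from 0, so [num_alive n m s] is the number of players
   still alive at the start of the round with index [s]. *)
Definition num_alive (n r : nat) (m : 'I_r -> nat) (s : nat) : nat :=
  (n - \sum_(j < r | j < s) m j)%N.

Definition is_format (n r : nat) (m : 'I_r -> nat) : Prop :=
  [/\ (0 < r)%N,
      (forall s : 'I_r, 0 < m s)%N,
      (\sum_(s < r) m s = n - 1)%N &
      (forall s : 'I_r, 2 * m s <= num_alive n m s)%N].

Section Tournament.
Variables (R : realType) (T : finType).
Implicit Types (v : T -> R) (A B C : {set T}).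

Definition beat_prob v (i j : T) : R := v i / (v i + v j).

Definition draws (m : nat) A : {set {set T}} :=
  [set C : {set T} | (C \subset A) && (#|C| == 2 * m)%N].

(* The match with index [k] opposes [f (k, true)] and [f (k, false)].  Matches
   and the two sides of a match are labelled; every set of [m] unordered pairs
   with union [C] comes from the same number, [m`! * 2 ^ m], of arrangements,
   so a uniform arrangement induces a uniform unordered pairing. *)
Definition arrangements (m : nat) C : {set {ffun 'I_m * bool -> T}} :=
  [set f : {ffun 'I_m * bool -> T} |
    injectiveb f && ([set f x | x : 'I_m * bool] == C)].

(* An outcome [w] of the matches records that [f (k, w k)] wins match [k]. *)
Definition losers (m : nat) (f : {ffun 'I_m * bool -> T})
    (w : {ffun 'I_m -> bool}) : {set T} :=
  [set f (k, ~~ w k) | k : 'I_m].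

Definition outcome_prob v (m : nat) (f : {ffun 'I_m * bool -> T})
    (w : {ffun 'I_m -> bool}) : R :=
  \prod_(k < m) beat_prob v (f (k, w k)) (f (k, ~~ w k)).

(* Conditional probability that [B] is the set of players alive after a round
   with [m] matches, given that [A] is the set of players alive before it. *)
Definition round_prob v (m : nat) A B : R :=
  \sum_(C in draws m A) #|draws m A|%:R^-1 *
    (\sum_(f in arrangements m C) #|arrangements m C|%:R^-1 *
      (\sum_(w | A :\: losers f w == B) outcome_prob v f w)).

(* Joint law of the successive sets of alive players: [H s] is the set of
   players alive at the start of the round with index [s], and [H ord_max] the
   set of players left after the last round.  This is the path law of a Markov
   chain, since a round depends on the past only through the alive players. *)
Definition history_prob v (r : nat) (m : 'I_r -> nat)
    (H : {ffun 'I_r.+1 -> {set T}}) : R :=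
  (H ord0 == [set: T])%:R *
  \prod_(s < r) round_prob v (m s) (H (widen_ord (leqnSn r) s))
                                   (H (lift ord0 s)).

Definition win_prob v (r : nat) (m : 'I_r -> nat) (i : T) : R :=
  \sum_(H : {ffun 'I_r.+1 -> {set T}} | H ord_max == [set i])
    history_prob v m H.

End Tournament.

(* Main.v *)
Require Import Defs.
From HB Require Import structures.
From mathcomp Require Import all_boot all_order all_algebra.
From mathcomp Require Import reals.
From mathcomp Require Import perm lra.
Set Implicit Arguments.
Unset Strict Implicit.
Unset Printing Implicit Defensive.
Import Order.TTheory GRing.Theory Num.Theory.
Local Open Scope ring_scope.

(** Write [S A] for the total value of a set [A] of players.  For a strongest
    player [i], the quantity [v i / S A] if [i] is alive, and [0] otherwise, is
    a submartingale along the successive sets [A] of alive players; for a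
    weakest player it is a supermartingale.  It starts at [v i / S setT] and
    ends as the indicator of the event that [i] wins, which gives both bounds
    ([path_sum_ge] is the induction over the rounds).

    For one round from [A] to [B], the value shares [v c / S B] of the survivors
    add up to [1], so [1 = \sum_(c in A) v c * E((c \in B) / S B)].  If each
    expectation on the right is at most [E((i \in B) / S B)], then
    [1 <= S A * E((i \in B) / S B)], which is the submartingale property
    ([share_sub], and dually [share_super]).  It therefore suffices to show that
    [E((c \in B) / S B) <= E((i \in B) / S B)] whenever [v c <= v i]
    ([survival_mono]).

    When both or none of [i] and [c] survive, the two integrands agree.  The
    other outcomes are compared by exchanging the names of [i] and [c] in
    the arrangement of the matches while keeping the labels of the winning
    sides.  This replaces an outcome where [i] survives and [c] loses by one
    where [c] survives and [i] loses, and does not increase the probability of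
    the outcome divided by the total value of the survivors ([swap_le]).
    Indeed, the survivors other than [i] and [c] are the same, of total value [s] say.
    In a match won by [i] against another opponent than [c], the win is at most
    as likely once [c] takes the place of [i].  If [i] beat [c], the comparison
    is that [x / (s + x)] increases with [x].
    If [c] lost to another player [w], it reads
    [(v w + v c) * (s + v i) <= (v w + v i) * (s + v c)], that is
    [0 <= (v i - v c) * (s - v w)], and [v w <= s] because [w] survives. *)

(** * Path sums of a Markov chain *)

Section Path.
Variables (R : realType) (X : finType).

Definition ffcons r (x : X) (H : {ffun 'I_r -> X}) : {ffun 'I_r.+1 -> X} :=
  [ffun s => if unlift ord0 s is Some t then H t else x].

Lemma ffcons0 r x (H : {ffun 'I_r -> X}) : ffcons x H ord0 = x.
Proof. by rewrite ffunE unlift_none. Qed.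

Lemma ffconsS r x (H : {ffun 'I_r -> X}) t : ffcons x H (lift ord0 t) = H t.
Proof. by rewrite ffunE liftK. Qed.

Lemma sum_ffcons r (F : {ffun 'I_r.+1 -> X} -> R) :
  \sum_H F H = \sum_x \sum_(H : {ffun 'I_r -> X}) F (ffcons x H).
Proof.
rewrite pair_bigA /=.
apply: (reindex (fun p : X * {ffun 'I_r -> X} => ffcons p.1 p.2)).
exists (fun H : {ffun 'I_r.+1 -> X} =>
    (H ord0, [ffun t : 'I_r => H (lift ord0 t)])) => [[x H] _|H _] /=.
  by rewrite ffcons0; congr (_, _); apply/ffunP => t; rewrite ffunE ffconsS.
apply/ffunP => s; case: (unliftP ord0 s) => [t ->|->].
  by rewrite ffconsS ffunE.
by rewrite ffcons0.
Qed.

(** Induction on the number of steps: for transition probabilities [K], the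
    sum below is the expectation of [g] at the final state of the chain started
    at [x0], and conditioning on the first step leaves a shorter chain.  The set
    [D s] contains the states that the chain can reach in [s] steps; in the
    tournament it fixes the number of players alive, which makes the round
    playable and leaves one player at the end. *)
Lemma path_sum_ge r (K : 'I_r -> X -> X -> R) (D : nat -> pred X)
    (f g : X -> R) :
    (forall s x y, 0 <= K s x y) ->
    (forall (s : 'I_r) x y, D s x -> K s x y != 0 -> D s.+1 y) ->
    (forall (s : 'I_r) x, D s x -> f x <= \sum_y K s x y * f y) ->
    (forall x, D r x -> f x <= g x) ->
  forall x0, D 0 x0 ->
  f x0 <= \sum_(H : {ffun 'I_r.+1 -> X})
    (H ord0 == x0)%:R *
    (\prod_(s < r) K s (H (widen_ord (leqnSn r) s)) (H (lift ord0 s))) *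
    g (H ord_max).
Proof.
elim: r K D => [|r IH] K D K0 KD fK fg x0 Dx0; rewrite sum_ffcons.
  rewrite (bigD1 x0) //= [X in _ + X]big1 => [|x xx0]; last first.
    by rewrite big1 // => H _; rewrite ffcons0 (negPf xx0) !mul0r.
  pose H0 : {ffun 'I_0 -> X} := [ffun=> x0].
  rewrite addr0 (big_pred1 H0) => [|H]; last first.
    by apply/esym/eqP/ffunP => -[].
  rewrite big_ord0 ffcons0 eqxx !mul1r.
  have -> : ord_max = ord0 :> 'I_1 by apply: val_inj.
  by rewrite ffcons0; apply: fg.
rewrite (bigD1 x0) //= [X in _ + X]big1 => [|x xx0]; last first.
  by rewrite big1 // => H _; rewrite ffcons0 (negPf xx0) !mul0r.
rewrite addr0.
apply: (le_trans (fK ord0 x0 Dx0)).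
pose P (H : {ffun 'I_r.+1 -> X}) := \prod_(s < r)
  K (lift ord0 s) (H (widen_ord (leqnSn r) s)) (H (lift ord0 s)).
have E H : (ffcons x0 H ord0 == x0)%:R *
    (\prod_(s < r.+1) K s (ffcons x0 H (widen_ord (leqnSn r.+1) s))
                          (ffcons x0 H (lift ord0 s))) *
    g (ffcons x0 H ord_max) =
    \sum_y K ord0 x0 y * ((H ord0 == y)%:R * P H * g (H ord_max)).
  have -> : ord_max = lift ord0 ord_max :> 'I_r.+2 by apply: val_inj.
  rewrite ffcons0 eqxx mul1r ffconsS big_ord_recl.
  have -> : widen_ord (leqnSn r.+1) ord0 = ord0 by apply: val_inj.
  rewrite ffcons0 ffconsS (bigD1 (H ord0)) //= [X in _ + X]big1 => [|y yH].
    rewrite eqxx mul1r addr0 -mulrA; congr (_ * (_ * _)).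
    apply: eq_bigr => s _; rewrite ffconsS.
    have -> : widen_ord (leqnSn r.+1) (lift ord0 s) =
              lift ord0 (widen_ord (leqnSn r) s) by apply: val_inj.
    by rewrite ffconsS.
  by rewrite eq_sym (negPf yH) !mul0r mulr0.
rewrite (eq_bigr _ (fun H _ => E H)) exchange_big /=.
apply: ler_sum => y _; rewrite -mulr_sumr.
have [->|Ky] := eqVneq (K ord0 x0 y) 0; first by rewrite !mul0r.
apply: ler_wpM2l => //.
apply: (IH (fun s => K (lift ord0 s)) (fun s => D s.+1)) => //.
- by move=> s x z; apply: (KD (lift ord0 s)).
- by move=> s x; apply: (fK (lift ord0 s)).
- exact: (KD ord0 _ _ Dx0 Ky).
Qed.

End Path.

(** * The law of one round *)

Section Round.
Variables (R : realType) (T : finType) (v : T -> R).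
Hypothesis v_gt0 : forall i, 0 < v i.
Implicit Types (A B C : {set T}) (m : nat).

Definition total A : R := \sum_(j in A) v j.

Definition placements m A : {set {ffun 'I_m * bool -> T}} :=
  [set f in ffun_on (mem A) | injectiveb f].

Lemma placementsP m A (f : {ffun 'I_m * bool -> T}) :
  reflect ((forall z, f z \in A) /\ injective f) (f \in placements m A).
Proof.
rewrite inE; apply: (iffP andP) => -[fA fi].
  by split; [apply/ffun_onP | apply/injectiveP].
by split; [apply/ffun_onP | apply/injectiveP].
Qed.

Lemma card_matches m : #|{: 'I_m * bool}| = (2 * m)%N.
Proof. by rewrite card_prod card_ord card_bool mulnC. Qed.

Lemma card_placements m A : #|placements m A| = (#|A| ^_ (2 * m))%N.
Proof. by rewrite card_inj_ffuns_on card_matches. Qed.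

Lemma card_image_placement m A (f : {ffun 'I_m * bool -> T}) :
  f \in placements m A -> #|[set f x | x : 'I_m * bool]| = (2 * m)%N.
Proof. by case/placementsP => _ fi; rewrite card_imset // card_matches. Qed.

Lemma arrangementsE m C :
  #|C| = (2 * m)%N -> arrangements m C = placements m C.
Proof.
move=> cC; apply/setP => f; rewrite inE; apply/andP/placementsP.
  move=> [/injectiveP fi /eqP <-]; split=> // z; exact: imset_f.
move=> [fC fi]; split; first exact/injectiveP.
rewrite eqEcard card_imset // card_matches cC leqnn andbT.
by apply/subsetP => _ /imsetP[z _ ->].
Qed.

(** Drawing the participants and then arranging them amounts to choosing
    a uniform injection of the [2 * m] seats into [A]. *)
Lemma round_probE m A B : round_prob v m A B =
  (#|A| ^_ (2 * m))%:R^-1 * \sum_(f in placements m A)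
    \sum_(w | A :\: losers f w == B) outcome_prob v f w.
Proof.
have cD : #|draws m A| = 'C(#|A|, 2 * m).
  by rewrite -cards_draws; apply: eq_card => C; rewrite !inE.
rewrite /round_prob -bin_ffact natrM invfM -mulrA -cD -mulr_sumr.
congr (_ * _).
rewrite (partition_big (fun f : {ffun 'I_m * bool -> T} =>
  [set f x | x : 'I_m * bool]) (mem (draws m A))) /= => [|f fA]; last first.
  rewrite inE (card_image_placement fA) eqxx andbT.
  by apply/subsetP => _ /imsetP[z _ ->]; case/placementsP: fA.
rewrite mulr_sumr; apply: eq_bigr => C; rewrite inE => /andP[CA /eqP cC].
rewrite -mulr_sumr {1}(arrangementsE cC) card_placements cC ffactnn.
congr (_ * _); apply: eq_bigl => f.
rewrite inE; apply/andP/andP => -[].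
  move=> /injectiveP fi /eqP fC; split; last exact/eqP.
  apply/placementsP; split=> // z; apply: (subsetP CA).
  by rewrite -fC imset_f.
by move=> /placementsP[_ fi] fC; split=> //; exact/injectiveP.
Qed.

Lemma round_mean m A (g : {set T} -> R) :
  \sum_B round_prob v m A B * g B =
  (#|A| ^_ (2 * m))%:R^-1 * \sum_(f in placements m A)
    \sum_w outcome_prob v f w * g (A :\: losers f w).
Proof.
under eq_bigr => B _ do rewrite round_probE -mulrA mulr_suml.
rewrite -mulr_sumr exchange_big /=; congr (_ * _); apply: eq_bigr => f _.
rewrite [RHS](partition_big (fun w => A :\: losers f w) predT) //=.
apply: eq_bigr => B _; rewrite mulr_suml.
by apply: eq_bigr => w /eqP->.
Qed.

Lemma beat_prob_ge0 i j : 0 <= beat_prob v i j.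
Proof. by rewrite divr_ge0 ?addr_ge0 // ltW. Qed.

Lemma outcome_prob_ge0 m (f : {ffun 'I_m * bool -> T}) w :
  0 <= outcome_prob v f w.
Proof. by apply: prodr_ge0 => k _; apply: beat_prob_ge0. Qed.

Lemma round_prob_ge0 m A B : 0 <= round_prob v m A B.
Proof.
rewrite round_probE mulr_ge0 ?invr_ge0 ?ler0n //.
by do 2!apply: sumr_ge0 => ? _; apply: outcome_prob_ge0.
Qed.

Lemma sum_outcome_prob m (f : {ffun 'I_m * bool -> T}) :
  \sum_w outcome_prob v f w = 1.
Proof.
rewrite /outcome_prob -(bigA_distr_bigA (fun k b =>
  beat_prob v (f (k, b)) (f (k, ~~ b)))).
apply: big1 => k _; rewrite big_bool /= /beat_prob.
rewrite [v (f (k, false)) + _]addrC -mulrDl divff //.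
by rewrite gt_eqF ?addr_gt0.
Qed.

Lemma round_prob_sum m A : (2 * m <= #|A|)%N -> \sum_B round_prob v m A B = 1.
Proof.
move=> mA; under eq_bigr => B _ do rewrite -[round_prob _ _ _ _]mulr1.
rewrite (round_mean _ _ (fun=> 1)).
under eq_bigr => f _ do [under eq_bigr => w _ do rewrite mulr1;
  rewrite sum_outcome_prob].
by rewrite sumr_const card_placements mulVf // pnatr_eq0 -lt0n ffact_gt0.
Qed.

Lemma losers_sub m A (f : {ffun 'I_m * bool -> T}) w :
  f \in placements m A -> losers f w \subset A.
Proof. by case/placementsP=> fA _; apply/subsetP => _ /imsetP[k _ ->]. Qed.

Lemma card_losers m A (f : {ffun 'I_m * bool -> T}) w :
  f \in placements m A -> #|losers f w| = m.
Proof.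
case/placementsP=> _ fi; rewrite card_imset ?card_ord // => k l /fi.
by case.
Qed.

(** The support of a round.  It turns the format into a constraint on the
    sizes of the sets along the chain, and shows that eliminated players do not
    come back. *)
Lemma round_prob_neq0 m A B :
  round_prob v m A B != 0 -> B \subset A /\ #|B| = (#|A| - m)%N.
Proof.
move=> h; have [/existsP[f /andP[fA /existsP[w /eqP <-]]]|nfB] :=
  boolP [exists f in placements m A, [exists w, A :\: losers f w == B]].
  rewrite subsetDl cardsD (setIidPr (losers_sub w fA)).
  by rewrite (card_losers w fA).
case/eqP: h; rewrite round_probE big1 ?mulr0 // => f fA.
rewrite big1 // => w wB; case/negP: nfB.
by apply/existsP; exists f; rewrite fA; apply/existsP; exists w.
Qed.

(** * Exchanging two players *)

Lemma total_gt0 A i : i \in A -> 0 < total A.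
Proof.
move=> iA; rewrite /total (bigD1 i) //=.
by rewrite ltr_wpDr // sumr_ge0 // => j _; exact/ltW.
Qed.

Definition relabel m (s : {perm T}) (f : {ffun 'I_m * bool -> T}) :
  {ffun 'I_m * bool -> T} := [ffun z => s (f z)].

Lemma losers_relabel m s (f : {ffun 'I_m * bool -> T}) w :
  losers (relabel s f) w = s @: losers f w.
Proof.
rewrite /losers -imset_comp; apply: eq_imset => k /=.
by rewrite ffunE.
Qed.

Lemma imset_tperm A i c : i \in A -> c \in A -> tperm i c @: A = A.
Proof.
move=> iA cA; apply/eqP; rewrite eqEcard card_imset; last exact: perm_inj.
rewrite leqnn andbT; apply/subsetP => _ /imsetP[x xA ->].
by case: tpermP.
Qed.

Lemma mem_imset_tperm A i c x : (x \in tperm i c @: A) = (tperm i c x \in A).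
Proof.
by rewrite -{1}[x](tpermK i c) mem_imset //; exact: perm_inj.
Qed.

Lemma survivors_relabel m A i c (f : {ffun 'I_m * bool -> T}) w :
  i \in A -> c \in A ->
  A :\: losers (relabel (tperm i c) f) w =
  tperm i c @: (A :\: losers f w).
Proof.
move=> iA cA; apply/setP => x.
rewrite losers_relabel -{1}(imset_tperm iA cA) !(inE, mem_imset_tperm).
by rewrite andbC.
Qed.

Lemma relabel_placements m A i c (f : {ffun 'I_m * bool -> T}) :
  i \in A -> c \in A ->
  (relabel (tperm i c) f \in placements m A) = (f \in placements m A).
Proof.
move=> iA cA.
have imp h : h \in placements m A -> relabel (tperm i c) h \in placements m A.
  case/placementsP => hA hi; apply/placementsP; split=> [z|z z'].
    by rewrite ffunE; case: tpermP.
  by rewrite !ffunE => /perm_inj /hi.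
apply/idP/idP => [/imp|/imp //].
suff -> : relabel (tperm i c) (relabel (tperm i c) f) = f by [].
by apply/ffunP => z; rewrite !ffunE tpermK.
Qed.

(** The exchange puts [c] in the place of [i] in a set [A] of survivors, so
    only one term of the total value changes. *)
Lemma total_swap A i c : i \in A -> c \notin A ->
  total (tperm i c @: A) = total (A :\ i) + v c.
Proof.
move=> iA cA; rewrite /total big_imset /=; last by move=> x y _ _ /perm_inj.
rewrite (big_setD1 i) //= tpermL addrC; congr (_ + _).
apply: eq_bigr => x; rewrite !inE => /andP[xi xA]; rewrite tpermD 1?eq_sym //.
by apply: contraNneq cA => <-.
Qed.

(** The probability is a product over the matches.  The match lost by [c] is
    compared together with the total value, as its factor alone may increase;
    all other factors are compared one by one. *)
Lemma swap_le m A i c (f : {ffun 'I_m * bool -> T}) w :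
    v c <= v i -> i \in A :\: losers f w -> c \in losers f w ->
    f \in placements m A ->
  outcome_prob v (relabel (tperm i c) f) w /
    total (tperm i c @: (A :\: losers f w)) <=
  outcome_prob v f w / total (A :\: losers f w).
Proof.
set B := A :\: losers f w => ci iB cL /placementsP[fA fi].
have cB : c \notin B by rewrite inE cL.
rewrite total_swap // /total (big_setD1 i iB) /= -/(total (B :\ i)).
set s := total (B :\ i).
have s0 : 0 <= s by apply: sumr_ge0 => j _; exact/ltW.
have [vi vc] := (v_gt0 i, v_gt0 c).
have iL : i \notin losers f w by move: iB; rewrite inE => /andP[].
have loser_neq_i j : f (j, ~~ w j) != i.
  by apply: contraNneq iL => <-; apply: imset_f.
case/imsetP: cL => k _ ck.
rewrite /outcome_prob (bigD1 k) //= [X in _ <= X / _](bigD1 k) //=.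
rewrite !ffunE -ck tpermR.
set P := \prod_(j < m | j != k) _; set Q := \prod_(j < m | j != k) _.
have P0 : 0 <= P by apply: prodr_ge0 => j _; apply: beat_prob_ge0.
have PQ : P <= Q.
  apply: ler_prod => j jk; rewrite beat_prob_ge0 /= !ffunE.
  have lc : f (j, ~~ w j) != c.
    by rewrite ck; apply: contra jk => /eqP /fi [->].
  have wc : f (j, w j) != c.
    by rewrite ck; apply: contra jk => /eqP /fi [->].
  rewrite (tpermD (z := f (j, ~~ w j))) 1?eq_sym //.
  have vl := v_gt0 (f (j, ~~ w j)).
  case: tpermP => // [->|/eqP]; last by rewrite (negPf wc).
  rewrite /beat_prob ler_pdivrMr ?addr_gt0 // mulrAC ler_pdivlMr ?addr_gt0 //.
  by rewrite !mulrDr [v i * v c]mulrC lerD2l ler_pM2r.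
(* It remains to compare the factors of the match lost by [c]. *)
suff main : beat_prob v (tperm i c (f (k, w k))) i / (s + v c) <=
            beat_prob v (f (k, w k)) c / (v i + s).
  rewrite mulrAC [X in _ <= X]mulrAC; apply: ler_pM => //.
  by rewrite divr_ge0 ?beat_prob_ge0 // addr_ge0 // ltW.
rewrite /beat_prob; have [fk|fk] := eqVneq (f (k, w k)) i.
  rewrite fk tpermL [v c + v i]addrC mulrAC [X in _ <= X]mulrAC.
  rewrite ler_pM2r ?invr_gt0 ?addr_gt0 //.
  rewrite ler_pdivrMr ?ltr_wpDl // mulrAC ler_pdivlMr ?ltr_wpDr //.
  by nra.
have fc : f (k, w k) != c.
  by rewrite ck; apply/eqP => /fi [] /esym; case: (w k).
rewrite tpermD 1?eq_sym //.
have vW := v_gt0 (f (k, w k)).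
have sW : v (f (k, w k)) <= s.
  rewrite /s /total (bigD1 (f (k, w k))) /=; last first.
    rewrite !inE fk fA andbT /=; apply/imsetP => -[j _ /fi [-> ]].
    by case: (w j).
  by rewrite lerDl sumr_ge0 // => j _; exact/ltW.
have s_gt0 : 0 < s := lt_le_trans vW sW.
rewrite -!mulrA ler_pM2l // -!invfM lef_pV2 ?posrE ?mulr_gt0 ?addr_gt0 //.
by nra.
Qed.

(** The exchange maps the outcomes where only [i] survives bijectively to
    those where only [c] survives, so [swap_le] can be summed. *)
Lemma survival_mono m A i c : i \in A -> c \in A -> v c <= v i ->
  \sum_B round_prob v m A B * ((c \in B)%:R / total B) <=
  \sum_B round_prob v m A B * ((i \in B)%:R / total B).
Proof.
move=> iA cA ci.
(* Outcomes where both or none of [i] and [c] survive count equally. *)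
pose only x y B : R := ((x \in B) && (y \notin B))%:R / total B.
pose both B : R := ((i \in B) && (c \in B))%:R / total B.
have split_c B : (c \in B)%:R / total B = both B + only c i B.
  rewrite /both /only -mulrDl.
  by case: (c \in B); case: (i \in B); rewrite /= ?addr0 ?add0r.
have split_i B : (i \in B)%:R / total B = both B + only i c B.
  rewrite /both /only -mulrDl.
  by case: (c \in B); case: (i \in B); rewrite /= ?addr0 ?add0r.
under eq_bigr => B _ do rewrite split_c mulrDr.
under [X in _ <= X]eq_bigr => B _ do rewrite split_i mulrDr.
rewrite !big_split lerD2l !round_mean.
apply: ler_wpM2l; first by rewrite invr_ge0 ler0n.
rewrite (reindex_inj (h := @relabel m (tperm i c))) /=; last first.
  move=> f g /ffunP fg; apply/ffunP => z.
  by have := fg z; rewrite !ffunE => /perm_inj.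
under eq_bigl => f do rewrite relabel_placements //.
apply: ler_sum => f fA; apply: ler_sum => w _.
rewrite survivors_relabel // /only !mem_imset_tperm tpermL tpermR.
have [/andP[iB cB]|_] := boolP (_ && _); last by rewrite !mul0r !mulr0.
rewrite !mul1r; apply: swap_le => //.
by move: cB; rewrite inE cA andbT negbK.
Qed.

(** * One round changes the value share of an extreme player monotonically *)

Definition share i B : R := (i \in B)%:R * (v i / total B).

Lemma share_notin m A i : i \notin A ->
  \sum_B round_prob v m A B * share i B = 0.
Proof.
move=> iA; apply: big1 => B _.
have [->|/round_prob_neq0[BA _]] := eqVneq (round_prob v m A B) 0.
  by rewrite mul0r.
rewrite /share; case: (boolP (i \in B)) => [/(subsetP BA)|_].
  by rewrite (negPf iA).
by rewrite mul0r mulr0.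
Qed.

(** The survivors' shares of their total value add up to [1]; the average over
    the round, with the sums exchanged, is this identity.  At least one player
    survives since each match has a winner. *)
Lemma sum_value_survival m A : (2 * m <= #|A|)%N -> (0 < #|A|)%N ->
  \sum_(c in A) v c * (\sum_B round_prob v m A B * ((c \in B)%:R / total B))
  = 1.
Proof.
move=> mA A0; rewrite -[RHS](round_prob_sum mA).
under eq_bigr => c _ do rewrite mulr_sumr.
rewrite exchange_big /=; apply: eq_bigr => B _.
have [->|/round_prob_neq0[BA cB]] := eqVneq (round_prob v m A B) 0.
  by apply: big1 => c _; rewrite mul0r mulr0.
have [c cinB] : exists c, c \in B.
  apply/set0Pn; rewrite -card_gt0 cB subn_gt0.
  by case: (m) mA => // p; apply: leq_trans; rewrite ltn_Pmull.
under eq_bigr => j _ do rewrite mulrCA.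
rewrite -mulr_sumr -[RHS]mulr1; congr (_ * _).
under eq_bigr => j _ do rewrite mulrA.
rewrite -mulr_suml; apply: (canLR (mulfK _)).
  by rewrite gt_eqF // (total_gt0 cinB).
rewrite mul1r (big_setID B) /= (setIidPr BA) [X in _ + X]big1 ?addr0.
  by apply: eq_bigr => j ->; rewrite mulr1.
by move=> j; rewrite inE => /andP[/negPf-> _]; rewrite mulr0.
Qed.

Lemma sum_share m A i : \sum_B round_prob v m A B * share i B =
  v i * \sum_B round_prob v m A B * ((i \in B)%:R / total B).
Proof.
rewrite mulr_sumr; apply: eq_bigr => B _; rewrite /share.
by rewrite [RHS]mulrCA; congr (_ * _); rewrite mulrCA.
Qed.

(** [survival_mono] bounds each term of [sum_value_survival] by the term of
    [i], which turns the sum into [total A] times the expectation wanted. *)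
Lemma share_sub m A i : (2 * m <= #|A|)%N -> (forall c, v c <= v i) ->
  share i A <= \sum_B round_prob v m A B * share i B.
Proof.
move=> mA vmax; have [iA|iA] := boolP (i \in A); last first.
  by rewrite share_notin // /share (negPf iA) mul0r.
rewrite sum_share /share iA mul1r ler_pM2l //.
rewrite -[_^-1]mul1r ler_pdivrMr ?(total_gt0 iA) //.
have A0 : (0 < #|A|)%N by apply/card_gt0P; exists i.
rewrite -[leLHS](sum_value_survival mA A0) mulrC /total mulr_suml.
by apply: ler_sum => c cA; rewrite ler_pM2l // survival_mono.
Qed.

Lemma share_super m A i : (2 * m <= #|A|)%N -> (forall c, v i <= v c) ->
  \sum_B round_prob v m A B * share i B <= share i A.
Proof.
move=> mA vmin; have [iA|iA] := boolP (i \in A); last first.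
  by rewrite share_notin // /share (negPf iA) mul0r.
rewrite sum_share /share iA mul1r ler_pM2l //.
rewrite -[_^-1]mul1r ler_pdivlMr ?(total_gt0 iA) //.
have A0 : (0 < #|A|)%N by apply/card_gt0P; exists i.
rewrite -[leRHS](sum_value_survival mA A0) mulrC /total mulr_suml.
by apply: ler_sum => c cA; rewrite ler_pM2l // survival_mono.
Qed.

Lemma share_final i B : #|B| = 1%N -> share i B = (B == [set i])%:R.
Proof.
move=> /eqP/cards1P[j ->]; rewrite /share inE /total big_set1.
rewrite (inj_eq set1_inj) eq_sym; case: eqVneq => [->|_]; last by rewrite mul0r.
by rewrite mul1r divff // gt_eqF.
Qed.

End Round.

(** * The whole tournament *)

Lemma num_alive0 n r (m : 'I_r -> nat) : num_alive n m 0 = n.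
Proof. by rewrite /num_alive big_pred0 ?subn0. Qed.

Lemma num_aliveS n r (m : 'I_r -> nat) (s : 'I_r) :
  num_alive n m s.+1 = (num_alive n m s - m s)%N.
Proof.
rewrite /num_alive -subnDA (bigD1 s) //= addnC; congr (_ - (_ + _))%N.
by apply: eq_bigl => j; rewrite ltnS [in RHS]ltn_neqAle andbC.
Qed.

Lemma num_alive_end n r (m : 'I_r -> nat) : (0 < n)%N ->
  (\sum_(s < r) m s = n - 1)%N -> num_alive n m r = 1%N.
Proof.
move=> n0 sm; rewrite /num_alive; under eq_bigl => j do rewrite ltn_ord.
by rewrite sm subKn.
Qed.

(** Both bounds follow from this statement, with [e = 1] and [e = -1]. *)
Lemma signed_share_le_win_prob (R : realType) (T : finType) (v : T -> R)
    (r : nat) (m : 'I_r -> nat) (e : R) (i : T) :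
    (0 < #|T|)%N -> (forall j, 0 < v j) -> is_format #|T| m ->
    (forall (s : 'I_r) (A : {set T}), (2 * m s <= #|A|)%N ->
       e * share v i A <=
       e * \sum_B round_prob v (m s) A B * share v i B) ->
  e * (v i / \sum_j v j) <= e * win_prob v m i.
Proof.
move=> T0 v0 [_ _ sm hm] he.
have share0 : v i / \sum_j v j = share v i [set: T].
  rewrite /share inE mul1r /total; congr (_ / _).
  by apply: eq_bigl => j; rewrite inE.
rewrite share0 /win_prob mulr_sumr [leRHS]big_mkcond /=.
apply: le_trans (path_sum_ge (K := fun s => round_prob v (m s))
  (D := fun s A => #|A| == num_alive #|T| m s)
  (f := fun A => e * share v i A) (g := fun A => e * (A == [set i])%:R)
  _ _ _ _ _) _.
- by move=> s A B; apply: round_prob_ge0.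
- move=> s A B /eqP cA /round_prob_neq0[_ ->].
  by rewrite num_aliveS cA.
- move=> s A /eqP cA; have := he s A; rewrite cA => /(_ (hm s)).
  by rewrite mulr_sumr; under eq_bigr => B _ do rewrite mulrCA.
- move=> A; rewrite num_alive_end // => /eqP cA.
  by rewrite -(share_final v0 i cA).
- by rewrite num_alive0 cardsT.
apply: ler_sum => H _.
rewrite /history_prob mulrCA.
by case: (H ord_max == _); rewrite ?mulr1 ?mulr0.
Qed.

Theorem theorem1 (R : realType) (n : nat) (hn : (2 <= n)%N)
    (v : 'I_n -> R)
    (v_gt0 : forall i : 'I_n, 0 < v i)
    (v_noninc : forall i j : 'I_n, (i <= j)%N -> v j <= v i)
    (r : nat) (m : 'I_r -> nat) (hm : is_format n m)
    (first last : 'I_n)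
    (hfirst : nat_of_ord first = 0%N)
    (hlast : nat_of_ord last = (n - 1)%N) :
  win_prob v m first >= v first / \sum_(j < n) v j /\
  win_prob v m last <= v last / \sum_(j < n) v j.
Proof.
have n0 : (0 < #|'I_n|)%N by rewrite card_ord; apply: leq_trans hn.
have hm' : is_format #|'I_n| m by rewrite card_ord.
split.
  rewrite -[leLHS]mul1r -[leRHS]mul1r.
  apply: signed_share_le_win_prob => // s A mA; rewrite !mul1r.
  by apply: share_sub => // c; apply: v_noninc; rewrite hfirst.
rewrite -lerN2 -[leLHS]mulN1r -[leRHS]mulN1r.
apply: signed_share_le_win_prob => // s A mA; rewrite !mulN1r lerN2.
apply: share_super => // c; apply: v_noninc.
by rewrite hlast subn1 -ltnS prednK ?ltn_ord //; apply: leq_trans hn.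
Qed.
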